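(* Let $\mu>0$, $L>0$, and let $f:\mathbb{R}^d\to\mathbb{R}$ be a $\mu$-strongly convex function. Suppose that for every anchor $\boldsymbol{z}\in\mathbb{R}^d$ the function $f$ is majorized by a surrogate $g(\cdot\mid\boldsymbol{z})$ anchored at $\boldsymbol{z}$, and that the surrogates are uniformly $L$-smooth, i.e. each $g(\cdot\mid\boldsymbol{z}):\mathbb{R}^d\to\mathbb{R}$ is differentiable and its gradient (in the first argument) is Lipschitz continuous with the same constant $L$, independent of $\boldsymbol{z}$. If the global minimum of $f$ occurs at $\boldsymbol{y}$, then the MM iterates $\{\boldsymbol{x}_n\}_{n\ge0}$ satisfy, for all $n\ge 0$, $$f(\boldsymbol{x}_n)-f(\boldsymbol{y})\;\le\;\left[1-\left(\frac{\mu}{L}\right)^2\right]^n[f(\boldsymbol{x}_0)-f(\boldsymbol{y})],$$ and thus $\boldsymbol{x}_n$ converges to $\boldsymbol{y}$ at a linear (geometric) rate, i.e. there are constants $K\ge0$ and $r\in[0,1)$ with $\|\boldsymbol{x}_n-\boldsymbol{y}\|\le K r^n$ for all $n\ge 0$.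
   Context: $\|\cdot\|$ is the Euclidean norm. $f$ is $\mu$-strongly convex if $f(\boldsymbol{x})-\frac{\mu}{2}\|\boldsymbol{x}\|^2$ is convex. A surrogate $g(\cdot\mid\boldsymbol{z})$ majorizes $f$ at the anchor $\boldsymbol{z}$ if $g(\boldsymbol{z}\mid\boldsymbol{z})=f(\boldsymbol{z})$ and $f(\boldsymbol{x})\le g(\boldsymbol{x}\mid\boldsymbol{z})$ for all $\boldsymbol{x}$. The MM algorithm starts at some $\boldsymbol{x}_0$ and takes $\boldsymbol{x}_{n+1}$ to be a minimizer of $\boldsymbol{x}\mapsto g(\boldsymbol{x}\mid\boldsymbol{x}_n)$ (minimizers are assumed to exist). The convention $t^0=1$ is used for all $t\ge 0$. *)

(* Defs.v *)
From mathcomp Require Import all_boot all_order all_algebra.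
From mathcomp Require Import all_classical all_reals all_analysis.
Set Implicit Arguments.
Unset Strict Implicit.
Unset Printing Implicit Defensive.
Import Order.TTheory GRing.Theory Num.Theory.
Import numFieldNormedType.Exports.
Local Open Scope classical_set_scope.
Local Open Scope ring_scope.

(* The library norm `|x| on 'rV[R]_d is the sup norm, hence this definition.
   Both norms induce the same topology, so the library's [differentiable] is
   differentiability on Euclidean space. *)
Definition l2norm (R : realType) (d : nat) (x : 'rV[R]_d) : R :=
  Num.sqrt (\sum_(i < d) x 0 i ^+ 2).

Definition strongly_convex (R : realType) (d : nat) (mu : R)
    (f : 'rV[R]_d -> R) : Prop :=
  convex_function setT (fun x : 'rV[R]_d => f x - mu / 2 * l2norm x ^+ 2).

Definition minimizer (R : realType) (T : Type) (h : T -> R) (y : T) : Prop :=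
  forall x, h y <= h x.

Definition gradient (R : realType) (d : nat) (h : 'rV[R]_d -> R)
    (x : 'rV[R]_d) : 'rV[R]_d :=
  \row_(i < d) 'D_(delta_mx 0 i) h x.

Definition smooth (R : realType) (d : nat) (L : R) (h : 'rV[R]_d -> R) : Prop :=
  (forall x, differentiable h x) /\
  (forall u v, l2norm (gradient h u - gradient h v) <= L * l2norm (u - v)).

(* In all that follows, [g x z] stands for g(x | z): the anchor is the second
   argument. *)
Definition majorizes_at (R : realType) (d : nat)
    (g : 'rV[R]_d -> 'rV[R]_d -> R) (f : 'rV[R]_d -> R) (z : 'rV[R]_d) : Prop :=
  g z z = f z /\ (forall x, f x <= g x z).

Definition MM_iterates (R : realType) (d : nat)
    (g : 'rV[R]_d -> 'rV[R]_d -> R) (x : nat -> 'rV[R]_d) : Prop :=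
  forall n, minimizer (g^~ (x n)) (x n.+1).

(* Main.v *)
(* Let z = x_n, p the gradient of g(.|z) at z, and v = y - z. Smoothness gives
   g(z + u | z) <= f(z) + <p, u> + L/2 |u|^2. Taking u = - p/L and comparing
   with the minimizer x_(n+1) yields f(x_(n+1)) <= f(z) - |p|^2/(2L). Since
   g(.|z) touches f from above at z, p also behaves like a strong subgradient
   of f: z lies between z - t v and y, so strong convexity together with the
   quadratic upper bound at u = - t v gives, as t -> 0,
   f(y) >= f(z) + <p, v> + mu/2 |v|^2 >= f(z) - |p|^2/(2 mu).
   The two bounds give the contraction factor 1 - mu/L. If mu > L this factor
   is negative, which forces f(x_n) = f(y) for all n; otherwise it is at most
   1 - (mu/L)^2. *)

Require Import Defs.
From mathcomp Require Import ring lra.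
From mathcomp Require Import all_boot all_order all_algebra.
From mathcomp Require Import all_classical all_reals all_analysis.
Set Implicit Arguments.
Unset Strict Implicit.
Unset Printing Implicit Defensive.
Import Order.TTheory GRing.Theory Num.Theory.
Import numFieldNormedType.Exports.
Local Open Scope ring_scope.

Definition dot (R : realType) (d : nat) (a b : 'rV[R]_d) : R :=
  \sum_(i < d) a 0 i * b 0 i.

Section Dot.
Context {R : realType} {d : nat}.
Implicit Types a b c : 'rV[R]_d.

Lemma dotC a b : dot a b = dot b a.
Proof. by apply: eq_bigr => i _; rewrite mulrC. Qed.

Lemma dotDl a b c : dot (a + b) c = dot a c + dot b c.
Proof. by rewrite -big_split; apply: eq_bigr => i _; rewrite mxE mulrDl. Qed.

Lemma dotZl k a b : dot (k *: a) b = k * dot a b.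
Proof. by rewrite /dot mulr_sumr; apply: eq_bigr => i _; rewrite mxE mulrA. Qed.

Lemma dotNl a b : dot (- a) b = - dot a b.
Proof. by rewrite -scaleN1r dotZl mulN1r. Qed.

Lemma dotDr a b c : dot a (b + c) = dot a b + dot a c.
Proof. by rewrite dotC dotDl !(dotC a). Qed.

Lemma dotZr k a b : dot a (k *: b) = k * dot a b.
Proof. by rewrite dotC dotZl dotC. Qed.

Lemma dotNr a b : dot a (- b) = - dot a b.
Proof. by rewrite dotC dotNl dotC. Qed.

Definition dotE := (dotDl, dotDr, dotZl, dotZr, dotNl, dotNr).

Lemma dot_ge0 a : 0 <= dot a a.
Proof. by apply: sumr_ge0 => i _; rewrite -expr2 sqr_ge0. Qed.

Lemma l2norm_sqr a : l2norm a ^+ 2 = dot a a.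
Proof.
rewrite /l2norm sqr_sqrtr; last by apply: sumr_ge0 => i _; rewrite sqr_ge0.
by apply: eq_bigr => i _; rewrite expr2.
Qed.

Lemma l2norm_ge0 a : 0 <= l2norm a.
Proof. exact: sqrtr_ge0. Qed.

(** Stands in for Cauchy-Schwarz: expand [|a - s b|^2 >= 0]. *)
Lemma dot_young (s : R) a b : 2 * s * dot a b <= dot a a + s ^+ 2 * dot b b.
Proof. by have := dot_ge0 (a - s *: b); rewrite !dotE (dotC b a); lra. Qed.

End Dot.

Lemma derive_dot_gradient (R : realType) (d : nat) (h : 'rV[R]_d -> R)
    (x v : 'rV[R]_d) :
  differentiable h x -> 'D_v h x = dot (gradient h x) v.
Proof.
move=> dh; rewrite deriveE// [v in LHS]row_sum_delta linear_sum.
by apply: eq_bigr => i _; rewrite linearZ/= mxE deriveE// mulrC.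
Qed.

(** Along the line, the difference quotient in direction 1 is that of [h] in direction [u]. *)
Lemma is_derive_line (R : realType) (d : nat) (h : 'rV[R]_d -> R)
    (z u : 'rV[R]_d) (t : R) :
  differentiable h (z + t *: u) ->
  is_derive t (1 : R) (fun s : R => h (z + s *: u))
    (dot (gradient h (z + t *: u)) u).
Proof.
move=> dh.
have dqE : (fun s : R => s^-1 *: (((fun s : R => h (z + s *: u)) \o shift t)
      (s *: (1 : R)) - h (z + t *: u))) =
    (fun s : R => s^-1 *: ((h \o shift (z + t *: u)) (s *: u) -
      h (z + t *: u))).
  apply/funext => s /=; congr (_ *: (h _ - _)).
  by rewrite [s *: 1]mulr1 scalerDl addrCA.
split; first by rewrite /derivable dqE; exact: diff_derivable.
by rewrite -derive_dot_gradient// /derive dqE.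
Qed.

Lemma smooth_quadratic_upper_bound (R : realType) (d : nat) (L : R)
    (h : 'rV[R]_d -> R) (z u : 'rV[R]_d) :
  0 < L -> smooth L h ->
  h (z + u) <= h z + dot (gradient h z) u + L / 2 * dot u u.
Proof.
move=> L0 [dh Lh].
(* The goal is [phi 1 <= phi 0]; by the mean value theorem, [dphi c <= 0] at the point [c] it
   provides is enough. *)
pose phi (t : R) : R :=
  h (z + t *: u) - dot (gradient h z) u * t - L / 2 * dot u u * t ^+ 2.
pose dphi (t : R) : R :=
  dot (gradient h (z + t *: u)) u - dot (gradient h z) u - L * dot u u * t.
have phi' t : is_derive t (1 : R) phi (dphi t).
  have dht := is_derive_line (dh (z + t *: u)).
  apply: is_derive_eq; rewrite /dphi /GRing.scale/=; lra.
have [|c] := @MVT _ phi dphi 0 1 ltr01 (fun t _ => phi' t).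
  apply: derivable_within_continuous => t _.
  exact: (@ex_derive _ _ _ _ _ _ _ (phi' t)).
rewrite in_itv/= => /andP[c0 _].
have : l2norm (gradient h (z + c *: u) - gradient h z) ^+ 2
    <= (L * c) ^+ 2 * dot u u.
  have := Lh (z + c *: u) z; rewrite addrAC subrr add0r.
  rewrite -ler_sqr ?nnegrE ?mulr_ge0 ?l2norm_ge0 ?(ltW L0)//.
  by rewrite [leRHS]exprMn !l2norm_sqr !dotE; lra.
rewrite l2norm_sqr.
have := dot_young (L * c) (gradient h (z + c *: u) - gradient h z) u.
set a := gradient h (z + c *: u) - gradient h z => young lip.
(* [young] and [lip] give [2Lc<a,u> <= 2(Lc)^2|u|^2]; [c] is interior, so [L * c] is positive and
   cancels. *)
have : dot a u <= L * c * dot u u.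
  have Lc : 0 < L * c by rewrite mulr_gt0.
  by rewrite -(ler_pM2l Lc); nra.
by rewrite /a /dphi /phi !dotE scale1r scale0r addr0; lra.
Qed.

(** The correction term comes from [t|a|^2 + (1-t)|b|^2 - |ta + (1-t)b|^2 = t(1-t)|a-b|^2]. *)
Lemma strongly_convex_le (R : realType) (d : nat) (mu : R)
    (f : 'rV[R]_d -> R) (a b : 'rV[R]_d) (t : R) :
  strongly_convex mu f -> 0 <= t <= 1 ->
  f (t *: a + (1 - t) *: b) <=
  t * f a + (1 - t) * f b - mu / 2 * (t * (1 - t)) * dot (a - b) (a - b).
Proof.
move=> fsc /andP[t0 t1].
have := fsc (Itv01 t0 t1) a b (in_setT _) (in_setT _).
rewrite convRE /conv/= /unstable.onem !l2norm_sqr.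
rewrite !dotE (dotC b a); lra.
Qed.

(** Replaces the passage to the limit [t -> 0]. *)
Lemma le0_of_le_small_mul (R : realFieldType) (a b : R) :
  (forall t, 0 < t <= 1 -> a <= t * b) -> a <= 0.
Proof.
move=> ab; rewrite leNgt; apply/negP => a0.
have := ab 1; rewrite ltr01 lexx mul1r => /(_ isT) leab.
have b0 : 0 < b by exact: lt_le_trans a0 leab.
(* This [t] is at most 1/2 because [a <= b], and it yields [a <= a / 2]. *)
have := ab (a / (2 * b)).
rewrite divr_gt0 ?mulr_gt0 ?ltr0n//= ler_pdivrMr ?mulr_gt0 ?ltr0n//.
rewrite mul1r invfM mulrA mulfVK ?gt_eqF//; lra.
Qed.

Lemma majorant_gradient_strong_subgradient (R : realType) (d : nat) (mu L : R)
    (f h : 'rV[R]_d -> R) (z y : 'rV[R]_d) :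
  0 < L -> strongly_convex mu f -> smooth L h ->
  h z = f z -> (forall u, f u <= h u) ->
  f z + dot (gradient h z) (y - z) + mu / 2 * dot (y - z) (y - z) <= f y.
Proof.
move=> L0 fsc hL hz fh; rewrite -subr_le0.
have [v vE] : {v | y - z = v} by exists (y - z).
have yE : y = z + v by rewrite -vE addrC subrK.
rewrite vE; set p := gradient h z.
(* The error [(L - mu)/2 t^2 |v|^2] combines both quadratic terms; one factor [t] is divided out. *)
apply: (@le0_of_le_small_mul _ _ ((L - mu) / 2 * dot v v)) => t /andP[t0 _].
have t1 : 0 < 1 + t by lra.
(* The weight [1/(1+t)] is the one for which [z] is the convex combination of [z - t v] and [y]. *)
have := strongly_convex_le (z - t *: v) y (t := (1 + t)^-1) fsc.
have -> : (1 + t)^-1 *: (z - t *: v) + (1 - (1 + t)^-1) *: y = z.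
  by apply/rowP => i; rewrite yE !mxE; field; lra.
have -> : z - t *: v - y = - (1 + t) *: v.
  by apply/rowP => i; rewrite yE !mxE; ring.
rewrite invr_ge0 (ltW t1) invf_le1// lerDl (ltW t0) !dotE => /(_ isT).
rewrite -(ler_pM2l t1).
have -> : (1 + t) * ((1 + t)^-1 * f (z - t *: v) + (1 - (1 + t)^-1) * f y -
    mu / 2 * ((1 + t)^-1 * (1 - (1 + t)^-1)) *
    (- (1 + t) * (- (1 + t) * dot v v))) =
    f (z - t *: v) + t * f y - mu / 2 * t * (1 + t) * dot v v.
  by field; lra.
have := smooth_quadratic_upper_bound z (- (t *: v)) L0 hL.
have := fh (z - t *: v); rewrite hz !dotE -/p => fub hub conv.
by rewrite -(ler_pM2l t0); lra.
Qed.

Lemma MM_step_contraction (R : realType) (d : nat) (mu L : R)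
    (f h : 'rV[R]_d -> R) (z x y : 'rV[R]_d) :
  0 < mu -> 0 < L -> strongly_convex mu f -> smooth L h ->
  h z = f z -> (forall u, f u <= h u) -> minimizer h x ->
  f x - f y <= (1 - mu / L) * (f z - f y).
Proof.
move=> mu0 L0 fsc hL hz fh xmin.
have := majorant_gradient_strong_subgradient y L0 fsc hL hz fh.
set p := gradient h z; set v := y - z => lower.
(* Amounts to [<p,v> + mu/2 |v|^2 >= -|p|^2/(2 mu)], the minimum over [v]. *)
have young := dot_young (- mu) p v.
have upper : L * (f x - f z) <= - (dot p p / 2).
  have := smooth_quadratic_upper_bound z (- L^-1 *: p) L0 hL.
  have := le_trans (fh x) (xmin (z + - L^-1 *: p)).
  rewrite hz -/p !dotE -(ler_pM2l L0) => hx.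
  rewrite -(ler_pM2l L0) => /(le_trans hx).
  have -> : L * (f z + - L^-1 * dot p p +
      L / 2 * (- L^-1 * (- L^-1 * dot p p))) = L * f z - dot p p / 2.
    by field; lra.
  lra.
have gap : mu * (f z - f y) <= dot p p / 2.
  move: lower; rewrite -(ler_pM2l mu0); nra.
rewrite -(ler_pM2l L0).
have -> : L * ((1 - mu / L) * (f z - f y)) = (L - mu) * (f z - f y).
  by field; lra.
lra.
Qed.

(** Compare [y] with the midpoint: [f y <= (f x + f y)/2 - mu/8 |x - y|^2]. *)
Lemma strongly_convex_minimizer_growth (R : realType) (d : nat) (mu : R)
    (f : 'rV[R]_d -> R) (x y : 'rV[R]_d) :
  strongly_convex mu f -> minimizer f y ->
  mu / 4 * l2norm (x - y) ^+ 2 <= f x - f y.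
Proof.
move=> fsc ymin.
have := strongly_convex_le x y (t := 2^-1) fsc.
have := ymin (2^-1 *: x + (1 - 2^-1) *: y).
have half01 : 0 <= (2^-1 : R) <= 1 by lra.
by rewrite l2norm_sqr => ymid /(_ half01); lra.
Qed.

Theorem proposition2p10 (R : realType) (d : nat) (mu L : R)
    (f : 'rV[R]_d -> R) (g : 'rV[R]_d -> 'rV[R]_d -> R)
    (x : nat -> 'rV[R]_d) (y : 'rV[R]_d)
    (mu_gt0 : 0 < mu) (L_gt0 : 0 < L)
    (f_sc : strongly_convex mu f)
    (g_maj : forall z, majorizes_at g f z)
    (g_smooth : forall z, smooth L (fun u => g u z))
    (y_min : minimizer f y)
    (x_MM : MM_iterates g x) :
  (forall n : nat,
     f (x n) - f y <= (1 - (mu / L) ^+ 2) ^+ n * (f (x 0%N) - f y)) /\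
  (exists K r : R, [/\ 0 <= K, 0 <= r < 1 &
     forall n : nat, l2norm (x n - y) <= K * r ^+ n]).
Proof.
have gap_ge0 n : 0 <= f (x n) - f y by rewrite subr_ge0.
have step n : f (x n.+1) - f y <= (1 - mu / L) * (f (x n) - f y).
  have [gz fg] := g_maj (x n).
  exact: MM_step_contraction mu_gt0 L_gt0 f_sc (g_smooth (x n)) gz fg (x_MM n).
have muL0 : 0 < mu / L by rewrite divr_gt0.
(* Kept general in [q], which is [1 - (mu/L)^2] if [mu <= L] and 0 otherwise; [q >= 0] lets the
   induction multiply inequalities. *)
have rate (q : R) : 0 <= q -> 1 - mu / L <= q ->
    forall n, f (x n) - f y <= q ^+ n * (f (x 0%N) - f y).
  move=> q0 rq; elim=> [|n IH]; first by rewrite expr0 mul1r.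
  apply: (le_trans (step n)); rewrite exprS -mulrA.
  by apply: (le_trans (ler_wpM2r (gap_ge0 n) rq)); rewrite ler_wpM2l.
have dist (q : R) : 0 <= q < 1 -> 1 - mu / L <= q ->
    exists K r : R, [/\ 0 <= K, 0 <= r < 1 &
      forall n : nat, l2norm (x n - y) <= K * r ^+ n].
  move=> /andP[q0 q1] rq.
  (* Growth at the minimizer bounds the squared distance by [4/mu] times the gap, hence the square
     roots. *)
  exists (Num.sqrt (4 / mu * (f (x 0%N) - f y))), (Num.sqrt q).
  split; rewrite ?sqrtr_ge0//=.
    by rewrite -sqrtr1 ltr_sqrt.
  move=> n; rewrite -ler_sqr ?nnegrE ?mulr_ge0 ?exprn_ge0 ?sqrtr_ge0
    ?l2norm_ge0//.
  have K0 : 0 <= 4 / mu * (f (x 0%N) - f y).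
    by rewrite mulr_ge0 ?divr_ge0 ?(ltW mu_gt0).
  rewrite exprMn -exprM mulnC exprM (sqr_sqrtr K0) (sqr_sqrtr q0).
  have mu4 : 0 < mu / 4 by rewrite divr_gt0.
  rewrite -(ler_pM2l mu4).
  apply: (le_trans (strongly_convex_minimizer_growth (x n) f_sc y_min)).
  apply: (le_trans (rate q q0 rq n)); rewrite le_eqVlt; apply/orP; left.
  by apply/eqP; field; lra.
have [muL|Lmu] := leP (mu / L) 1.
  have q0 : 0 <= 1 - (mu / L) ^+ 2 by nra.
  have rq : 1 - mu / L <= 1 - (mu / L) ^+ 2 by nra.
  split; first exact: rate.
  apply: (dist _ _ rq); rewrite q0/=; nra.
(* A positive gap at [n] would make the next one negative. *)
have gap0 n : f (x n) - f y = 0.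
  apply/eqP; rewrite eq_le gap_ge0 andbT.
  have := gap_ge0 n.+1; have := step n; have := gap_ge0 n; nra.
split=> [n|]; first by rewrite !gap0 mulr0.
(* With [q = 0] the case [n = 0] relies on [0 ^+ 0 = 1]. *)
by apply: (dist 0); rewrite ?lexx ?ltr01//; lra.
Qed.
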